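(* Let $0\le\alpha<1$ be fixed and let $\mathbf v=\mathbf v^{(n)}$ be preference (probability) vectors with $v_i=O(1/n)$ for all $i$ (uniformly in $i$). Let $\mathcal G(w)$ be the Chung-Lu random graph on $n$ vertices with expected degrees $w_1,\dots,w_n$ (depending on $n$) such that $w_{\min}>\log^c(n)$ for some $c>1$ and $w_{\max}\le Kw_{\min}$ for some constant $K$ independent of $n$. Let $\boldsymbol\pi$ be the PageRank vector of $\mathcal G(w)$ with damping factor $\alpha$ and preference vector $\mathbf v$. Then $\boldsymbol\pi$ converges element-wise to $$\overline{\boldsymbol\pi}=(1-\alpha)\mathbf v+\alpha\,\mathbf d/\mathrm{vol}(G),\qquad \mathrm{vol}(G)=\sum_id_i,$$ in the sense that $$\max_i\frac{|\pi_i-\overline\pi_i|}{\overline\pi_i}=o(1)\quad\text{w.h.p.}$$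
   Context: Chung-Lu graph $\mathcal G(w)$: given positive reals $w_1,\dots,w_n$ with $\max_i w_i^2\le\sum_k w_k$, each pair of vertices $\{i,j\}$ is joined by an edge independently of all other pairs with probability $p_{ij}=w_iw_j/\sum_k w_k$ (pairs $i=j$, i.e. self-loops, included, so that the expected degree of vertex $i$ is exactly $w_i$). $w_{\max}=\max_iw_i$, $w_{\min}=\min_iw_i$. $\mathbf A$ is the symmetric $0/1$ adjacency matrix, $\mathbf d=(d_i)$ with $d_i=\sum_jA_{ij}$, $\mathbf D=\mathrm{diag}(\mathbf d)$, $\mathbf P=\mathbf A\mathbf D^{-1}$ (defined when all degrees are positive, part of the w.h.p. event). PageRank: for a (deterministic) probability vector $\mathbf v$ and $\alpha<1$, $\boldsymbol\pi=(1-\alpha)[\mathbf I-\alpha\mathbf P]^{-1}\mathbf v$, equivalently the stationary probability vector of $\alpha\mathbf P+(1-\alpha)\mathbf v\mathbf 1^T$. Convention: $0/0=0$ (only relevant for $\alpha=0$, when $\boldsymbol\pi=\overline{\boldsymbol\pi}=\mathbf v$). An event (depending on $n$) holds with high probability (w.h.p.) if there are $N$ and $c'>0$ such that its probability is at least $1-O(n^{-c'})$ for all $n>N$. Nonnegative random variables $X_n$ satisfy $X_n=o(1)$ w.h.p. if there is a deterministic function $\psi(n)=o(1)$ such that the event $\{X_n\le\psi(n)\}$ holds w.h.p. *)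

(* Defs.v *)
From HB Require Import structures.
From mathcomp Require Import all_boot all_order all_algebra.
From mathcomp Require Import all_classical all_reals all_analysis.
Set Implicit Arguments.
Unset Strict Implicit.
Unset Printing Implicit Defensive.
Import Order.TTheory GRing.Theory Num.Theory.
Import numFieldNormedType.Exports.
Local Open Scope ring_scope.

(* Unordered pairs {i, j} of vertices, with i = j allowed, each represented by
   its sorted ordered pair. *)
Definition vpair (n : nat) := {e : 'I_n * 'I_n | (e.1 <= e.2)%N}.

(* A graph is its edge set; self-loops are allowed. *)
Definition graph (n : nat) := {set vpair n}.

Definition joined (n : nat) (G : graph n) (i j : 'I_n) : bool :=
  [exists e in G, (val e == (i, j)) || (val e == (j, i))].

Section ChungLu.
Context {R : realType} {n : nat} (w : 'I_n -> R).

Definition wmax : R := \big[Num.max/0]_i w i.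

(* [wmax] is neutral for [Num.min] on the weights, so this is min_i w_i as soon
   as the weights are positive and 0 < n. *)
Definition wmin : R := \big[Num.min/wmax]_i w i.

Definition edge_prob (e : vpair n) : R :=
  w (val e).1 * w (val e).2 / \sum_k w k.

(* The product law: every pair is an edge independently of the others. *)
Definition chung_lu (G : graph n) : R :=
  \prod_(e : vpair n) (if e \in G then edge_prob e else 1 - edge_prob e).

Definition Pr (E : {set graph n}) : R := \sum_(G in E) chung_lu G.

End ChungLu.

Section PageRank.
Context (R : realType) {n : nat}.

(* A self-loop at i contributes 1 to [adjmx G i i], hence 1 to [deg G i]. *)
Definition adjmx (G : graph n) : 'M[R]_n :=
  \matrix_(i, j) (joined G i j)%:R.

Definition deg (G : graph n) : 'cV[R]_n := \col_i \sum_j adjmx G i j.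

Definition vol (G : graph n) : R := \sum_i deg G i 0.

(* [degmx] is invertible, and [transmx] is the intended matrix, exactly when
   all the degrees are positive. *)
Definition degmx (G : graph n) : 'M[R]_n := diag_mx (deg G)^T.

Definition transmx (G : graph n) : 'M[R]_n := adjmx G *m invmx (degmx G).

Definition pos_deg (G : graph n) : bool := [forall i, 0 < deg G i 0].

Definition pagerank (alpha : R) (v : 'cV[R]_n) (G : graph n) : 'cV[R]_n :=
  (1 - alpha) *: (invmx (1%:M - alpha *: transmx G) *m v).

Definition pagerank_lim (alpha : R) (v : 'cV[R]_n) (G : graph n) : 'cV[R]_n :=
  (1 - alpha) *: v + alpha *: ((vol G)^-1 *: deg G).

(* When all the degrees are positive, a denominator can vanish only if alpha = 0,
   where both vectors are equal to v; the quotient is then 0 / 0 = 0. *)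
Definition pagerank_err (alpha : R) (v : 'cV[R]_n) (G : graph n) : R :=
  \big[Num.max/0]_i (`|pagerank alpha v G i 0 - pagerank_lim alpha v G i 0|
                     / pagerank_lim alpha v G i 0).

End PageRank.

Definition prob_vector (R : realType) (n : nat) (v : 'cV[R]_n) : Prop :=
  (forall i, 0 <= v i 0) /\ \sum_i v i 0 = 1.

Definition whp (R : realType) (w : forall n, 'I_n -> R)
    (E : forall n, {set graph n}) : Prop :=
  exists (N : nat) (c C : R), 0 < c /\
    forall n : nat, (N < n)%N -> 1 - C * n%:R `^ (- c) <= Pr (w n) (E n).

(* Main.v *)
Require Import Defs.
From HB Require Import structures.
From mathcomp Require Import all_boot all_order all_algebra.
From mathcomp Require Import all_classical all_reals all_analysis.
From mathcomp Require Import ring lra.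
Import Order.TTheory GRing.Theory Num.Theory.
Import numFieldNormedType.Exports.
Local Open Scope classical_set_scope.
Local Open Scope ring_scope.

(** No spectral gap is needed: a single step of the random walk started from a
    spread-out preference vector already lands near the stationary distribution.

    Let [u = d / vol].  Since [P u = A 1 / vol = u], the difference [r] of the
    PageRank vector and its limit [(1 - alpha) v + alpha u] satisfies
      [(I - alpha P) r = alpha (1 - alpha) (P v - u)].
    If [|P v - u| <= eps u] entrywise, then [|r| <= alpha eps u] entrywise,
    because [P] is nonnegative and fixes [u]: this is the maximum principle
    [resolvent_bound], applied where [|r_i| / u_i] is largest.  As [alpha u] is
    at most the limit vector, the relative error is at most [eps]
    ([pagerank_err_le]).

    It remains to see that [P v] is close to [u].  Replacing the degrees in
    [(P v)_i = \sum_j A_ij v_j / d_j] by their means [w_j] gives a weighted sum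
    of independent indicators with mean
      [\sum_j (w_i w_j / W) (v_j / w_j) = w_i / W],  [W = \sum_k w_k],
    and [w_i / W] is also what [u_i = d_i / vol] becomes under that replacement.
    Hence it is enough that the [n] degrees and these [n] sums all lie within a
    factor [1 +- dl] of their means ([transmx_near_stationary]).  The weights
    [v_j / w_j] are at most [B / (n wmin)], so after division by this maximum
    the means are at least [wmin / (K B)], and those of the degrees are at least
    [wmin]: the Chernoff bound [chernoff] controls each deviation by
    [2 exp (- dl^2 wmin / (8 K B))].  With [wmin > (ln n)^c], the choice of
    [dl] proportional to [(ln n)^((1 - c) / 2)], which tends to 0 because
    [1 < c], makes this at most [2 n^-2], and the union bound over [2 n] events
    leaves a failure probability of at most [4 / n]. *)

(** * Concentration for a random subset with independent elements *)

(** [expR x <= (1 - x)^-1] comes from [1 - x <= expR (- x)], and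
    [(1 + x + 2 x^2) (1 - x) = 1 + x^2 (1 - 2 x)]. *)
Lemma expR_le_quadratic (R : realType) (x : R) :
  x <= 1 / 2 -> expR x <= 1 + x + 2 * x ^+ 2.
Proof.
move=> hx.
have e1 : 1 - x <= (expR x)^-1 by rewrite -expRN; exact: expR_ge1Dx.
have x1 : 0 < 1 - x by lra.
have e2 : expR x <= (1 - x)^-1.
  by rewrite -(invrK (expR x)) lef_pV2 // posrE ?invr_gt0 ?expR_gt0.
apply: (le_trans e2); rewrite -[(1 - x)^-1]mul1r ler_pdivrMr //.
have -> : (1 + x + 2 * x ^+ 2) * (1 - x) = 1 + x ^+ 2 * (1 - 2 * x) by ring.
have : 0 <= x ^+ 2 * (1 - 2 * x) by apply: mulr_ge0; [exact: sqr_ge0|lra].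
lra.
Qed.

Section RandomSubset.
Context {R : realType} {T : finType} (p : T -> R).
Context (p01 : forall e, 0 <= p e <= 1).

Definition subset_law (G : {set T}) : R :=
  \prod_e (if e \in G then p e else 1 - p e).

Lemma subset_law_ge0 G : 0 <= subset_law G.
Proof.
by apply: prodr_ge0 => e _; have := p01 e; case: ifP => _ /andP[? ?]; lra.
Qed.

Lemma subset_law_total : \sum_G subset_law G = 1.
Proof.
rewrite /subset_law -bigA_distr /= big1 // => e _; ring.
Qed.

(** Independence: the expectation of a product over the elements factorizes,
    which is the distributive law for [\prod_e (p e * f e + (1 - p e))]. *)
Lemma subset_law_prod (f : T -> R) :
  \sum_G subset_law G * (\prod_(e in G) f e) = \prod_e (1 + p e * (f e - 1)).
Proof.
transitivity (\prod_e (p e * f e + (1 - p e))).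
  rewrite bigA_distr; apply: eq_bigr => G _.
  rewrite /subset_law (big_mkcond (mem G)) -big_split /=.
  by apply: eq_bigr => e _; case: ifP => _; rewrite ?mulr1.
by apply: eq_bigr => e _; ring.
Qed.

(** The moment generating function of a centred sum.  The sign of [t] is left
    free so that one statement serves both tails. *)
Lemma subset_law_mgf (b : T -> R) (t : R) :
  (forall e, 0 <= b e <= 1) -> t <= 1 / 2 ->
  \sum_G subset_law G * expR (t * (\sum_(e in G) b e - \sum_e p e * b e))
    <= expR (2 * t ^+ 2 * \sum_e p e * b e).
Proof.
move=> b01 ht.
have splitE G :
    subset_law G * expR (t * (\sum_(e in G) b e - \sum_e p e * b e)) =
    subset_law G * (\prod_(e in G) expR (t * b e))
      * expR (- (t * \sum_e p e * b e)).
  by rewrite mulrBr expRD mulrA [X in _ * expR X * _]mulr_sumr expR_sum.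
rewrite (eq_bigr _ (fun G _ => splitE G)) -mulr_suml subset_law_prod.
rewrite expRN ler_pdivrMr ?expR_gt0 // -expRD.
have -> : 2 * t ^+ 2 * (\sum_e p e * b e) + t * (\sum_e p e * b e) =
    \sum_e p e * (t * b e + 2 * t ^+ 2 * b e).
  by rewrite -mulrDl mulr_sumr; apply: eq_bigr => e _; ring.
rewrite expR_sum; apply: ler_prod => e _.
have /andP[p0 p1] := p01 e; have /andP[b0 b1] := b01 e.
have eg := expR_gt0 (t * b e).
have h1 : 0 <= 1 + p e * (expR (t * b e) - 1).
  have : 0 <= p e * expR (t * b e) by rewrite mulr_ge0 // ltW.
  lra.
rewrite h1 /=; apply: le_trans (expR_ge1Dx _).
rewrite lerD2l; apply: ler_wpM2l => //.
have htb : t * b e <= 1 / 2.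
  have [t0|/ltW t0] := leP 0 t; first nra.
  have : t * b e <= 0 by rewrite mulr_le0_ge0.
  lra.
have := expR_le_quadratic _ _ htb.
have : (t * b e) ^+ 2 <= t ^+ 2 * b e.
  rewrite exprMn ler_wpM2l ?sqr_ge0 // expr2.
  by rewrite -{3}[b e]mulr1 ler_wpM2l.
lra.
Qed.

Lemma subset_law_union (I : finType) (Bad : I -> {set T} -> bool) :
  \sum_(G | [exists i, Bad i G]) subset_law G
    <= \sum_i \sum_(G | Bad i G) subset_law G.
Proof.
under [X in _ <= X]eq_bigr => i _ do rewrite big_mkcond.
rewrite exchange_big /= big_mkcond; apply: ler_sum => G _.
have nonneg i : 0 <= (if Bad i G then subset_law G else 0).
  by case: ifP => // _; exact: subset_law_ge0.
case: ifP => [/existsP[i bi]|_]; last exact: sumr_ge0.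
by rewrite (bigD1 i) //= bi lerDl sumr_ge0.
Qed.

(** Exponential Markov inequality at [t = dl / 4] and [t = - dl / 4], where the
    exponent [2 t^2 mu - |t| dl mu] is smallest; the condition [dl <= 2] keeps
    [t] in the range of the quadratic bound on the exponential. *)
Lemma chernoff (b : T -> R) (dl mu : R) :
  (forall e, 0 <= b e <= 1) -> 0 <= dl <= 2 ->
  mu = \sum_e p e * b e ->
  \sum_(G : {set T} | dl * mu < `|\sum_(e in G) b e - mu|) subset_law G
    <= 2 * expR (- (dl ^+ 2 * mu / 8)).
Proof.
move=> b01 /andP[d0 d2] muE.
pose Y (G : {set T}) := \sum_(e in G) b e - mu.
pose M t := \sum_(G : {set T}) subset_law G * expR (t * Y G).
have markov : \sum_(G : {set T} | dl * mu < `|Y G|) subset_law G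
    <= (M (dl / 4) + M (- (dl / 4))) * expR (- (dl ^+ 2 * mu / 4)).
  rewrite /M -big_split /= mulr_suml big_mkcond; apply: ler_sum => G _.
  have hL := subset_law_ge0 G.
  rewrite -mulrDr -mulrA mulrDl -!expRD.
  case: ifP => [dev|_]; last first.
    by apply: mulr_ge0 => //; apply: addr_ge0; exact: expR_ge0.
  rewrite -{1}[subset_law G]mulr1 ler_wpM2l //.
  have e1 := @expR_gt0 R (dl / 4 * Y G + - (dl ^+ 2 * mu / 4)).
  have e2 := @expR_gt0 R (- (dl / 4) * Y G + - (dl ^+ 2 * mu / 4)).
  have [y0|y0] := leP 0 (Y G).
    rewrite ger0_norm // in dev.
    have : 1 <= expR (dl / 4 * Y G + - (dl ^+ 2 * mu / 4)).
      apply: le_trans (expR_ge1Dx _); rewrite lerDl.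
      have -> : dl / 4 * Y G + - (dl ^+ 2 * mu / 4) = dl / 4 * (Y G - dl * mu).
        by ring.
      by apply: mulr_ge0; lra.
    lra.
  rewrite ltr0_norm // in dev.
  have : 1 <= expR (- (dl / 4) * Y G + - (dl ^+ 2 * mu / 4)).
    apply: le_trans (expR_ge1Dx _); rewrite lerDl.
    have -> : - (dl / 4) * Y G + - (dl ^+ 2 * mu / 4)
       = dl / 4 * (- Y G - dl * mu) by ring.
    by apply: mulr_ge0; lra.
  lra.
have m1 : M (dl / 4) <= expR (2 * (dl / 4) ^+ 2 * mu).
  by rewrite /M /Y muE; apply: subset_law_mgf => //; lra.
have m2 : M (- (dl / 4)) <= expR (2 * (- (dl / 4)) ^+ 2 * mu).
  by rewrite /M /Y muE; apply: subset_law_mgf => //; lra.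
rewrite sqrrN in m2; apply: (le_trans markov).
have -> : - (dl ^+ 2 * mu / 8) =
    2 * (dl / 4) ^+ 2 * mu + - (dl ^+ 2 * mu / 4) by field.
by rewrite expRD mulrA ler_wpM2r ?expR_ge0 //; lra.
Qed.

End RandomSubset.

(** * Closeness up to a factor *)

(** Unlike a bound on a relative error, this relation is symmetric, and it
    composes and inverts without loss, so that quotients and sums of
    approximately known quantities are handled by counting factors. *)
Definition within {R : realType} (q x y : R) := x <= q * y /\ y <= q * x.

Section Within.
Context {R : realType}.
Implicit Types q x y z : R.

Lemma within_sym q x y : within q x y -> within q y x.
Proof. by case. Qed.

Lemma within_trans q1 q2 x y z : 0 <= q1 -> 0 <= q2 ->
  within q1 x y -> within q2 y z -> within (q1 * q2) x z.
Proof.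
move=> q1_0 q2_0 [xy yx] [yz zy]; split.
  by apply: (le_trans xy); rewrite -mulrA ler_wpM2l.
by apply: (le_trans zy); rewrite -mulrA mulrCA ler_wpM2l.
Qed.

Lemma within_sum (I : finType) q (f g : I -> R) :
  (forall i, within q (f i) (g i)) -> within q (\sum_i f i) (\sum_i g i).
Proof.
by move=> fg; split; rewrite mulr_sumr; apply: ler_sum => i _; case: (fg i).
Qed.

Lemma within_mull q x y z : 0 <= z -> within q x y -> within q (z * x) (z * y).
Proof.
by move=> z0 [xy yx]; split; rewrite mulrCA ler_wpM2l.
Qed.

Lemma within_inv q x y : 0 < x -> 0 < y -> within q x y -> within q x^-1 y^-1.
Proof.
move=> x0 y0 [xy yx]; split.
  by rewrite ler_pdivlMr // mulrC ler_pdivrMr.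
by rewrite ler_pdivlMr // mulrC ler_pdivrMr.
Qed.

(** The lower bound [(1 - dl) y <= x] suffices since
    [(1 + 2 dl) (1 - dl) = 1 + dl (1 - 2 dl) >= 1]. *)
Lemma within_of_dist dl x y : 0 <= dl <= 1 / 2 -> 0 <= y ->
  `|x - y| <= dl * y -> within (1 + 2 * dl) x y.
Proof.
move=> /andP[d0 d1] y0; rewrite ler_norml => /andP[lo hi]; split.
  have : 0 <= dl * y by rewrite mulr_ge0.
  lra.
have : (1 + 2 * dl) * ((1 - dl) * y) <= (1 + 2 * dl) * x.
  by rewrite ler_wpM2l //; lra.
apply: le_trans.
have -> : (1 + 2 * dl) * ((1 - dl) * y) = y + dl * (1 - 2 * dl) * y by ring.
by rewrite lerDl !mulr_ge0 //; lra.
Qed.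

Lemma dist_of_within q x y : 1 <= q -> 0 <= y ->
  within q x y -> `|x - y| <= (q - 1) * y.
Proof.
move=> q1 y0 [xy yx]; rewrite ler_norml; apply/andP; split; last lra.
rewrite lerNl; have [x0|x0] := leP y x.
  have : 0 <= (q - 1) * y by rewrite mulr_ge0 //; lra.
  lra.
have : (q - 1) * x <= (q - 1) * y by rewrite ler_wpM2l //; lra.
lra.
Qed.

End Within.

(** * A maximum principle for resolvents *)

Section MaximumPrinciple.
Context {R : realType} {n : nat}.
Implicit Types (P : 'M[R]_n) (u r f : 'cV[R]_n) (alpha eta : R).

(** At an index where [|r i| / u i] has its maximum [m], the equation gives
    [m <= (1 - alpha) eta + alpha m]: averaging by [P] cannot exceed [m], since
    [P] is nonnegative and fixes [u]. *)
Lemma resolvent_bound P u r alpha eta :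
  0 <= alpha < 1 -> (forall i j, 0 <= P i j) -> (forall i, 0 < u i 0) ->
  P *m u = u ->
  (forall i, `|((1%:M - alpha *: P) *m r) i 0| <= (1 - alpha) * eta * u i 0) ->
  forall i, `|r i 0| <= eta * u i 0.
Proof.
move=> /andP[a0 a1] P0 u0 Pu hf i.
pose m i : R := `|r i 0| / u i 0.
case: (@arg_maxP _ R 'I_n i xpredT m erefl) => i0 _ imax.
have rE k : `|r k 0| = m k * u k 0 by rewrite /m divfK // gt_eqF.
have le_m k : `|r k 0| <= m i0 * u k 0.
  by rewrite rE ler_wpM2r ?(ltW (u0 _)) //; exact: imax.
apply: (le_trans (le_m i)); rewrite ler_wpM2r ?(ltW (u0 _)) //.
have Pr_le : `|(P *m r) i0 0| <= m i0 * u i0 0.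
  rewrite -[in X in _ <= X]Pu !mxE mulr_sumr.
  apply: (le_trans (ler_norm_sum _ _ _)); apply: ler_sum => k _.
  by rewrite normrM (ger0_norm (P0 _ _)) mulrCA ler_wpM2l.
have step : `|r i0 0| <= ((1 - alpha) * eta + alpha * m i0) * u i0 0.
  have -> : r i0 0 = ((1%:M - alpha *: P) *m r) i0 0 + alpha * (P *m r) i0 0.
    by rewrite mulmxBl mul1mx -scalemxAl !mxE subrK.
  apply: (le_trans (ler_normD _ _)); rewrite normrM (ger0_norm a0) mulrDl.
  by rewrite lerD // -mulrA ler_wpM2l.
rewrite rE ler_pM2r // in step.
have : (1 - alpha) * m i0 <= (1 - alpha) * eta by lra.
by rewrite ler_pM2l // subr_gt0.
Qed.

(** The maximum principle with [eta = 0] says that the kernel is trivial. *)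
Lemma resolvent_unitmx P u alpha :
  0 <= alpha < 1 -> (forall i j, 0 <= P i j) -> (forall i, 0 < u i 0) ->
  P *m u = u -> 1%:M - alpha *: P \in unitmx.
Proof.
move=> ha P0 u0 Pu; rewrite unitmxE unitfE -det_tr; apply/det0P => -[r rn0 r0].
have fr0 : (1%:M - alpha *: P) *m r^T = 0.
  by rewrite -[X in X *m _]trmxK -trmx_mul r0 trmx0.
case/negP: rn0; apply/eqP/rowP => i; rewrite [RHS]mxE.
have := @resolvent_bound P u r^T alpha 0 ha P0 u0 Pu _ i.
rewrite mul0r normr_le0 !mxE => h; apply/eqP/h => k.
by rewrite fr0 mxE normr0 mulr0 mul0r.
Qed.

End MaximumPrinciple.

(** * PageRank of a fixed graph *)

Section PageRankBound.
Context {R : realType} {n : nat}.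
Implicit Types (G : graph n) (v : 'cV[R]_n) (alpha eps : R).

Lemma adjmx_ge0 G i j : 0 <= (adjmx R G) i j.
Proof. by rewrite mxE ler0n. Qed.

Lemma transmxE G i j : pos_deg R G ->
  (transmx R G) i j = (adjmx R G) i j / (deg R G) j 0.
Proof.
move=> /forallP dpos.
pose dinv : 'rV[R]_n := \row_j ((deg R G) j 0)^-1.
have degV : degmx R G *m diag_mx dinv = 1%:M.
  apply/matrixP => k l; rewrite mul_diag_mx !mxE.
  have [->|_] := eqVneq k l; last by rewrite !mulr0n mulr0.
  by rewrite !mulr1n divff // gt_eqF //; have := dpos l; rewrite mxE.
have [degU _] := mulmx1_unit degV.
have -> : transmx R G = adjmx R G *m diag_mx dinv.
  by rewrite /transmx -[diag_mx dinv](mulKmx degU) degV mulmx1.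
by rewrite mul_mx_diag !mxE.
Qed.

Lemma vol_gt0 G (i : 'I_n) : pos_deg R G -> 0 < vol R G.
Proof.
move=> /forallP dpos; rewrite /vol (bigD1 i) //=.
by rewrite ltr_pwDl // sumr_ge0 // => k _; exact: ltW.
Qed.

Lemma deg_stationary G : pos_deg R G ->
  transmx R G *m ((vol R G)^-1 *: deg R G) = (vol R G)^-1 *: deg R G.
Proof.
move=> dpos; rewrite -scalemxAr; congr (_ *: _); apply/colP => i.
rewrite !mxE; apply: eq_bigr => j _; rewrite transmxE // divfK //.
by rewrite gt_eqF // (forallP dpos).
Qed.

(** One step of the walk from [v] controls the whole PageRank series: applying
    [1 - alpha P] to the error vector leaves [alpha (1 - alpha) (P v - u)], with
    [u = d / vol], and [resolvent_bound] turns this into [alpha eps u]. *)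
Lemma pagerank_err_le G v alpha eps :
  0 <= alpha < 1 -> 0 <= eps -> (forall i, 0 <= v i 0) -> pos_deg R G ->
  (forall i, `|(transmx R G *m v) i 0 - (deg R G) i 0 / vol R G|
               <= eps * ((deg R G) i 0 / vol R G)) ->
  pagerank_err alpha v G <= eps.
Proof.
move=> ha eps0 v0 dpos hPv; have /andP[a0 a1] := ha.
apply: bigmax_le => // i _.
have V0 := vol_gt0 _ i dpos.
set P := transmx R G in hPv; set u := (vol R G)^-1 *: deg R G.
have uE k : u k 0 = (deg R G) k 0 / vol R G by rewrite mxE mulrC.
have u0 k : 0 < u k 0 by rewrite uE divr_gt0 // (forallP dpos).
have P0 k l : 0 <= P k l.
  rewrite /P transmxE // divr_ge0 ?adjmx_ge0 // ltW //.
  exact: (forallP dpos).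
have Pu : P *m u = u := deg_stationary _ dpos.
have MU := resolvent_unitmx _ _ _ ha P0 u0 Pu.
pose r := pagerank alpha v G - pagerank_lim alpha v G.
have resid : (1%:M - alpha *: P) *m r = (alpha * (1 - alpha)) *: (P *m v - u).
  rewrite mulmxBr /pagerank -scalemxAr mulKVmx // /pagerank_lim -/u.
  rewrite mulmxDr -(scalemxAr (1 - alpha)) -(scalemxAr alpha).
  rewrite !mulmxBl !mul1mx -!scalemxAl Pu.
  by apply/colP => k; rewrite !mxE; ring.
have rbound k : `|r k 0| <= alpha * eps * u k 0.
  apply: (@resolvent_bound _ _ P u r alpha) => // l.
  rewrite resid mxE normrM ger0_norm; last by rewrite mulr_ge0 // subr_ge0 (ltW a1).
  have -> : (1 - alpha) * (alpha * eps) * u l 0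
    = alpha * (1 - alpha) * (eps * u l 0) by ring.
  rewrite ler_wpM2l ?mulr_ge0 ?subr_ge0 ?(ltW a1) // [X in `|X|]mxE.
  by rewrite [(- u) _ _]mxE uE; exact: hPv.
have rE : pagerank alpha v G i 0 - pagerank_lim alpha v G i 0 = r i 0.
  by rewrite [in RHS]mxE [(- pagerank_lim _ _ _) _ _]mxE.
have limE : pagerank_lim alpha v G i 0 = (1 - alpha) * v i 0 + alpha * u i 0.
  by rewrite /pagerank_lim -/u !mxE.
have uv0 : 0 <= (1 - alpha) * v i 0 by rewrite mulr_ge0 // subr_ge0 (ltW a1).
have au0 : 0 <= alpha * u i 0 by rewrite mulr_ge0 // (ltW (u0 i)).
(* When the limit entry vanishes, the quotient is 0 because [0^-1 = 0]. *)
have [l0|l0] := ltP 0 (pagerank_lim alpha v G i 0).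
  rewrite ler_pdivrMr // rE limE (le_trans (rbound i)) //.
  by rewrite mulrDr -mulrA mulrCA lerDr mulr_ge0.
have -> : pagerank_lim alpha v G i 0 = 0.
  by apply/eqP; rewrite eq_le l0 limE addr_ge0.
by rewrite invr0 mulr0.
Qed.

(** Four replacements, each costing a factor [1 + 2 dl], lead from [(P v)_i] to
    [d_i / vol]: [d_j] by [w_j] in the sum, the sum by its mean [w_i / W],
    [w_i] by [d_i], and [W] by [vol].  The constant 30 makes
    [(1 + 2 dl)^4 - 1 <= 30 dl] hold up to [dl = 1 / 2]. *)
Lemma transmx_near_stationary G v (w : 'I_n -> R) (dl : R) :
  (forall i, 0 < w i) -> prob_vector v -> 0 <= dl <= 1 / 2 ->
  (forall i, `|(deg R G) i 0 - w i| <= dl * w i) ->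
  (forall i, `|\sum_j (adjmx R G) i j * (v j 0 / w j) - w i / \sum_k w k|
               <= dl * (w i / \sum_k w k)) ->
  pos_deg R G /\
  forall i, `|(transmx R G *m v) i 0 - (deg R G) i 0 / vol R G|
              <= 30 * dl * ((deg R G) i 0 / vol R G).
Proof.
move=> w0 [v0 _] dl01 hd hS; have /andP[dl0 dl1] := dl01.
have dpos : pos_deg R G.
  apply/forallP => i; have := hd i; rewrite ler_norml => /andP[lo _].
  have : dl * w i <= 1 / 2 * w i by rewrite ler_wpM2r // ltW.
  by have := w0 i; lra.
split=> // i.
have d0 k : 0 < (deg R G) k 0 := forallP dpos k.
have V0 := vol_gt0 _ i dpos.
have W0 : 0 < \sum_k w k.
  by rewrite (bigD1 i) //= ltr_pwDl // sumr_ge0 // => k _; exact: ltW.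
set q := 1 + 2 * dl; have q0 : 0 <= q by rewrite /q; lra.
have dw k : within q ((deg R G) k 0) (w k).
  by apply: within_of_dist => //; exact: ltW.
have Pv_S : within q ((transmx R G *m v) i 0)
    (\sum_j (adjmx R G) i j * (v j 0 / w j)).
  rewrite mxE; apply: within_sum => j; rewrite transmxE // -mulrA.
  apply: within_mull; first exact: adjmx_ge0.
  by rewrite mulrC; apply: within_mull => //; exact: within_inv.
have S_w : within q (\sum_j (adjmx R G) i j * (v j 0 / w j))
    (w i / \sum_k w k).
  by apply: within_of_dist => //; rewrite divr_ge0 ?ltW.
have w_dW : within q (w i / \sum_k w k) ((deg R G) i 0 / \sum_k w k).
  by rewrite ![_ / \sum_k w k]mulrC; apply: within_mull;
    [rewrite invr_ge0 ltW | exact/within_sym].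
have dW_u : within q ((deg R G) i 0 / \sum_k w k) ((deg R G) i 0 / vol R G).
  apply: within_mull; first exact: ltW.
  by apply: within_inv => //; apply: within_sum => k; exact/within_sym.
have wq : within (q * (q * (q * q))) ((transmx R G *m v) i 0)
    ((deg R G) i 0 / vol R G).
  do 3![apply: within_trans;
        [by rewrite ?mulr_ge0 | by rewrite ?mulr_ge0 | eassumption |]].
  exact: dW_u.
have q1 : 1 <= q * (q * (q * q)).
  by rewrite !mulr_ege1 // /q lerDl mulr_ge0.
have u0 : 0 <= (deg R G) i 0 / vol R G by rewrite divr_ge0 ?ltW.
apply: (le_trans (dist_of_within _ _ _ q1 u0 wq)).
rewrite ler_wpM2r //.
have -> : q * (q * (q * q)) - 1 =
  8 * dl + 24 * (dl * dl) + 32 * (dl * dl * dl) + 16 * (dl * dl * dl * dl).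
  by rewrite /q; ring.
have s2 : dl * dl <= 1 / 2 * dl by rewrite ler_wpM2r.
have s3 : dl * dl * dl <= 1 / 2 * dl * dl by rewrite !ler_wpM2r.
have s4 : dl * dl * dl * dl <= 1 / 2 * dl * dl * dl by rewrite !ler_wpM2r.
lra.
Qed.

End PageRankBound.

(** * Concentration of a row of the adjacency matrix *)

Section RowConcentration.
Context {R : realType} {n : nat}.

Definition sorted_pair (i j : 'I_n) := if (i <= j)%N then (i, j) else (j, i).

Lemma sorted_pair_le i j : ((sorted_pair i j).1 <= (sorted_pair i j).2)%N.
Proof. by rewrite /sorted_pair; case: (leqP i j) => // /ltnW. Qed.

Definition vpair_of (i j : 'I_n) : vpair n :=
  exist _ (sorted_pair i j) (sorted_pair_le i j).

Lemma vpair_of_inj i : injective (vpair_of i).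
Proof.
move=> j k /(congr1 val); rewrite /= /sorted_pair.
by case: leqP => _; case: leqP => _ [] // -> ->.
Qed.

Lemma joinedE (G : graph n) i j : joined G i j = (vpair_of i j \in G).
Proof.
apply/existsP/idP => [[[[a b] /= ab]] /andP[eG] /= hij|eG]; last first.
  exists (vpair_of i j); rewrite eG /= /sorted_pair.
  by case: leqP; rewrite eqxx ?orbT.
suff -> : vpair_of i j = exist _ (a, b) ab by [].
apply: val_inj; rewrite /= /sorted_pair; case/orP: hij => /eqP[? ?]; subst a b.
  by rewrite ab.
by case: leqP => // ij; congr pair; apply: val_inj; apply/eqP;
  rewrite eqn_leq ab ij.
Qed.

Context (w : 'I_n -> R) (w_pos : forall i, 0 < w i).
Context (w_CL : wmax w ^+ 2 <= \sum_k w k).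

Lemma edge_probE i j : edge_prob w (vpair_of i j) = w i * w j / \sum_k w k.
Proof.
rewrite /edge_prob /= /sorted_pair; case: ifP => //= _.
by rewrite [w j * _]mulrC.
Qed.

Lemma edge_prob01 e : 0 <= edge_prob w e <= 1.
Proof.
case: e => -[a b] ab; rewrite /edge_prob /=.
have W0 : 0 < \sum_k w k.
  by rewrite (bigD1 a) //= ltr_pwDl // sumr_ge0 // => k _; exact: ltW.
rewrite divr_ge0 ?mulr_ge0 ?(ltW W0) ?(ltW (w_pos _)) //= ler_pdivrMr // mul1r.
by apply: le_trans w_CL; rewrite expr2 ler_pM ?(ltW (w_pos _)) //; exact: le_bigmax.
Qed.

(** A weighted sum along row [i] of the adjacency matrix, seen as a sum over the
    edges.  For fixed [i] the map [vpair_of i] is injective, so the sum has at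
    most one term; writing it as a sum makes the change of variables below a
    plain partition. *)
Definition row_weight (i : 'I_n) (a : 'I_n -> R) (e : vpair n) : R :=
  \sum_(j | vpair_of i j == e) a j.

Lemma sum_row_weight i a (F : vpair n -> R) :
  \sum_e F e * row_weight i a e = \sum_j F (vpair_of i j) * a j.
Proof.
rewrite [RHS](partition_big (vpair_of i) xpredT) //=.
apply: eq_bigr => e _; rewrite mulr_sumr.
by apply: eq_bigr => j /eqP ->.
Qed.

(** The entries of one row are independent, being indicators of distinct pairs,
    so [chernoff] applies once the coefficients are scaled by their bound [M].
    Only a lower bound [lo] on the scaled mean enters the estimate. *)
Lemma row_concentration i (a : 'I_n -> R) (M lo dl mu : R) :
  (forall j, 0 <= a j <= M) -> 0 < M -> 0 <= dl <= 2 ->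
  mu = \sum_j w i * w j / (\sum_k w k) * a j -> lo <= mu / M ->
  \sum_(G : graph n | dl * mu < `|\sum_j (adjmx R G) i j * a j - mu|)
     chung_lu w G <= 2 * expR (- (dl ^+ 2 * lo / 8)).
Proof.
move=> a01 M0 dl02 muE hlo.
pose b := row_weight i (fun j => a j / M).
have b01 e : 0 <= b e <= 1.
  have a01' j : 0 <= a j / M <= 1.
    have /andP[? ?] := a01 j.
    by rewrite divr_ge0 ?(ltW M0) //= ler_pdivrMr // mul1r.
  rewrite /b /row_weight.
  have [j /eqP je|none] := pickP (fun j => vpair_of i j == e).
    rewrite (big_pred1 j) // => k /=.
    by rewrite -je (inj_eq (@vpair_of_inj i)).
  by rewrite big_pred0 // lexx ler01.
have meanE : mu / M = \sum_e edge_prob w e * b e.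
  rewrite sum_row_weight muE mulr_suml; apply: eq_bigr => j _.
  by rewrite edge_probE mulrA.
have rowE (G : graph n) :
    \sum_(e in G) b e = (\sum_j (adjmx R G) i j * a j) / M.
  transitivity (\sum_e (e \in G)%:R * b e).
    rewrite big_mkcond; apply: eq_bigr => e _.
    by case: (e \in G); rewrite ?mul1r ?mul0r.
  rewrite sum_row_weight mulr_suml; apply: eq_bigr => j _.
  by rewrite mxE joinedE mulrA.
apply: (@le_trans _ _ (2 * expR (- (dl ^+ 2 * (mu / M) / 8)))); last first.
  by rewrite ler_wpM2l // ler_expR lerN2 ler_wpM2r // ler_wpM2l ?sqr_ge0.
apply: le_trans (chernoff _ edge_prob01 b dl _ b01 dl02 meanE).
rewrite le_eqVlt; apply/orP; left; apply/eqP/eq_big => // G.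
rewrite rowE -mulrBl normrM (gtr0_norm (x := M^-1)) ?invr_gt0 //.
by rewrite mulrA ltr_pM2r ?invr_gt0.
Qed.

End RowConcentration.

(** * The bound for a fixed number of vertices *)

Section FiniteSize.
Context {R : realType} {n : nat} (w : 'I_n -> R).
Context (w_pos : forall i, 0 < w i) (wmin_pos : 0 < wmin w).
Context (w_CL : wmax w ^+ 2 <= \sum_k w k).

(** Union bound over the [2 n] row sums.  Stating it for any [kap >= K * B]
    spares the user of the lemma from knowing that [K * B] is positive. *)
Lemma pagerank_err_tail (alpha K B kap dl : R) (v : 'cV[R]_n) :
  0 <= alpha < 1 -> (0 < n)%N -> prob_vector v ->
  wmax w <= K * wmin w -> (forall i, v i 0 <= B / n%:R) ->
  K * B <= kap -> 0 <= dl <= 1 / 2 ->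
  1 - 4 * n%:R * expR (- (dl ^+ 2 * (wmin w / kap) / 8)) <=
    Pr w [set G : graph n |
           pos_deg R G && (pagerank_err alpha v G <= 30 * dl)]%SET.
Proof.
move=> ha n0 vprob hK hB kapKB dl01; have [v0 v1] := vprob.
have /andP[dl0 dl1] := dl01.
have nR : 0 < n%:R :> R by rewrite ltr0n.
have min_le i : wmin w <= w i := bigmin_le _ _ _.
have le_max i : w i <= wmax w := le_bigmax _ _ _.
pose i0 : 'I_n := Ordinal n0.
(* Both constants are at least 1: [wmin <= wmax], and the [n] entries of [v],
   each at most [B / n], add up to 1. *)
have K1 : 1 <= K.
  rewrite -(ler_pM2r wmin_pos) mul1r.
  exact: le_trans (min_le i0) (le_trans (le_max i0) hK).
have B1 : 1 <= B.
  rewrite -v1; apply: le_trans (ler_sum _ (fun i _ => hB i)) _.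
  by rewrite sumr_const card_ord -[_ *+ n]mulr_natr divfK // gt_eqF.
have K0 : 0 < K by lra.
have B0 : 0 < B by lra.
set W := \sum_k w k.
have W0 : 0 < W.
  by rewrite /W (bigD1 i0) //= ltr_pwDl // sumr_ge0 // => k _; exact: ltW.
have WnK : W <= n%:R * (K * wmin w).
  have : W <= \sum_(k < n) K * wmin w.
    by apply: ler_sum => k _; exact: le_trans (le_max k) hK.
  by rewrite sumr_const card_ord mulr_natl.
(* The flag [s] selects between the degrees and the sums of [v_j / w_j];
   [M] bounds the coefficients and [mu] is the mean. *)
pose a (s : bool) j := if s then 1 else v j 0 / w j.
pose M (s : bool) := if s then 1 else B / (n%:R * wmin w).
pose mu (s : bool) i := if s then w i else w i / W.
have M0 s : 0 < M s by case: s => //=; rewrite /M divr_gt0 // mulr_gt0.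
have aM s j : 0 <= a s j <= M s.
  case: s; rewrite /a /M ?ler01 ?lexx // divr_ge0 ?(ltW (w_pos _)) //=.
  rewrite ler_pdivrMr // (le_trans (hB j)) //.
  have -> : B / (n%:R * wmin w) * w j = B / n%:R * (w j / wmin w).
    by field; rewrite !gt_eqF.
  rewrite ler_peMr ?divr_ge0 ?(ltW B0) ?(ltW nR) //.
  by rewrite ler_pdivlMr // mul1r.
have muE s i : mu s i = \sum_j w i * w j / W * a s j.
  case: s; rewrite /mu /a.
    under eq_bigr => j _ do rewrite mulr1 mulrAC.
    by rewrite -mulr_sumr divfK // gt_eqF.
  transitivity (\sum_j w i / W * v j 0); first by rewrite -mulr_sumr v1 mulr1.
  by apply: eq_bigr => j _; field; rewrite !gt_eqF.
have lo s i : wmin w / kap <= mu s i / M s.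
  apply: (@le_trans _ _ (wmin w / (K * B))).
    rewrite ler_wpM2l ?(ltW wmin_pos) // lef_pV2 ?posrE //.
      by rewrite (lt_le_trans _ kapKB) ?mulr_gt0.
    by rewrite mulr_gt0.
  case: s; rewrite /mu /M.
    rewrite divr1 ler_pdivrMr ?mulr_gt0 // (le_trans (min_le i)) //.
    by rewrite ler_peMr ?(ltW (w_pos _)) // mulr_ege1.
  rewrite ler_pdivrMr ?mulr_gt0 //.
  have -> : w i / W / (B / (n%:R * wmin w)) * (K * B) =
            w i * ((n%:R * (K * wmin w)) / W).
    by field; rewrite !gt_eqF.
  rewrite (le_trans (min_le i)) // ler_peMr ?(ltW (w_pos _)) //.
  by rewrite ler_pdivlMr // mul1r.
pose Bad (si : bool * 'I_n) (G : graph n) :=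
  dl * mu si.1 si.2 < `|\sum_j (adjmx R G) si.2 j * a si.1 j - mu si.1 si.2|.
have bad_law : \sum_(G | [exists si, Bad si G]) chung_lu w G
    <= 4 * n%:R * expR (- (dl ^+ 2 * (wmin w / kap) / 8)).
  have := subset_law_union _ (edge_prob01 _ w_pos w_CL) _ Bad.
  move=> /le_trans; apply.
  have each si : \sum_(G | Bad si G) chung_lu w G
      <= 2 * expR (- (dl ^+ 2 * (wmin w / kap) / 8)).
    have dl02 : 0 <= dl <= 2 by lra.
    exact: (row_concentration w w_pos w_CL si.2 _ _ _ _ _ (aM si.1) (M0 si.1)
      dl02 (muE si.1 si.2) (lo si.1 si.2)).
  set bound := 2 * expR _ in each.
  apply: le_trans (ler_sum _ (fun si _ => each si)) _.
  rewrite sumr_const card_prod card_bool card_ord -[_ *+ (2 * n)]mulr_natl natrM.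
  by rewrite le_eqVlt; apply/orP; left; apply/eqP; rewrite /bound; ring.
have good (G : graph n) : ~~ [exists si, Bad si G] ->
    pos_deg R G && (pagerank_err alpha v G <= 30 * dl).
  rewrite negb_exists => /forallP ok.
  have {}ok s i : `|\sum_j (adjmx R G) i j * a s j - mu s i| <= dl * mu s i.
    by have := ok (s, i); rewrite /Bad /= -leNgt.
  have hd i : `|(deg R G) i 0 - w i| <= dl * w i.
    have := ok true i; rewrite /a /mu mxE.
    by under eq_bigr => j _ do rewrite mulr1.
  have [dpos hPv] :=
    transmx_near_stationary G v w dl w_pos vprob dl01 hd (ok false).
  by rewrite dpos pagerank_err_le // mulr_ge0.
have tot : \sum_G chung_lu w G = 1 := subset_law_total (edge_prob w).
rewrite lerBlDr -[X in X <= _]tot (bigID (fun G => [exists si, Bad si G])) /= addrC.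
rewrite lerD //= /Pr [X in X <= _]big_mkcond [X in _ <= X]big_mkcond /=.
apply: ler_sum => G _; rewrite inE.
have L0 : 0 <= chung_lu w G := subset_law_ge0 _ (edge_prob01 _ w_pos w_CL) G.
have [_|/good ->//] := boolP [exists si, Bad si G].
by case: ifP.
Qed.

End FiniteSize.

(** * The limit *)

Lemma cvg_ln_pinfty (R : realType) : (ln n%:R : R) @[n --> \oo] --> +oo%R.
Proof.
apply/cvgryPge => A.
near=> n.
have hn : expR A <= n%:R.
  by near: n; exact: (cvgryPge _).1 (@cvgr_idn R) (expR A).
by rewrite -[A]expRK ler_ln ?posrE ?expR_gt0 // (lt_le_trans _ hn) ?expR_gt0.
Unshelve. all: by end_near. Qed.

Lemma powRN_cvg0 (R : realType) (s : R) :
  0 < s -> x `^ (- s) @[x --> +oo] --> (0 : R).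
Proof.
move=> s0; apply/cvgrPdist_le => e e0; near=> x.
have x0 : 0 < x by near: x; exact: nbhs_pinfty_gt.
rewrite sub0r normrN ger0_norm ?powR_ge0 // powRN.
have -> : e = ((e `^ (- s^-1)) `^ s)^-1.
  by rewrite -powRrM mulNr mulVf ?gt_eqF // powR_inv1 ?invrK // ltW.
rewrite lef_pV2 ?posrE ?powR_gt0 //; apply: ge0_ler_powR;
  rewrite ?nnegrE ?powR_ge0 ?(ltW s0) ?(ltW x0) //.
Unshelve. all: by end_near. Qed.

Theorem theorem2 (R : realType) (alpha : R) (halpha : 0 <= alpha < 1)
    (w : forall n : nat, 'I_n -> R) (v : forall n : nat, 'cV[R]_n)
    (w_pos : forall (n : nat) (i : 'I_n), 0 < w n i)
    (w_CL : forall n : nat, wmax (w n) ^+ 2 <= \sum_k w n k)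
    (c : R) (hc : 1 < c)
    (w_log : \forall n \near \oo, ln n%:R `^ c < wmin (w n))
    (K : R) (w_ratio : \forall n \near \oo, wmax (w n) <= K * wmin (w n))
    (v_prob : forall n : nat, (0 < n)%N -> prob_vector (v n))
    (B : R) (v_bound : \forall n \near \oo, forall i : 'I_n, v n i 0 <= B / n%:R) :
  exists psi : nat -> R,
    psi n @[n --> \oo] --> (0 : R) /\
    whp w (fun n => [set G : graph n |
                      pos_deg R G && (pagerank_err alpha (v n) G <= psi n)]%SET).
Proof.
pose kap := Num.max (K * B) 1.
have KBkap : K * B <= kap by rewrite le_max lexx.
have kap1 : 1 <= kap by rewrite le_max lexx orbT.
pose s := (c - 1) / 2; have s0 : 0 < s by rewrite /s; lra.
(* The factor 4 makes [dl^2 * wmin / (8 * kap)] at least [2 * ln n]: each of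
   the [2 n] events then fails with probability at most [2 / n^2]. *)
pose dl (n : nat) : R := 4 * kap * ln n%:R `^ (- s).
have dl_cvg : dl n @[n --> \oo] --> (0 : R).
  rewrite -[X in _ --> X](mulr0 (4 * kap)); apply: cvgMr.
  exact: cvg_comp (cvg_ln_pinfty R) (powRN_cvg0 _ _ s0).
exists (fun n => 30 * dl n); split.
  by rewrite -[X in _ --> X](mulr0 30); apply: cvgMr.
have dl_half : \forall n \near \oo, dl n <= 1 / 2.
  near=> n; apply: le_trans (ler_norm _) _; near: n.
  by move/cvgr0Pnorm_le: dl_cvg; apply; lra.
have n_ge3 : \forall n \near \oo, (2 < n)%N by exists 3%N.
have : \forall n \near \oo, 1 - 4 * n%:R `^ (- 1) <=
    Pr (w n) [set G : graph n |
           pos_deg R G && (pagerank_err alpha (v n) G <= 30 * dl n)]%SET.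
  near=> n.
  have n3 : (2 < n)%N by near: n.
  have n0 : (0 < n)%N by exact: leq_trans n3.
  have L0 : 0 < ln n%:R :> R by rewrite ln_gt0 // ltr1n (leq_trans _ n3).
  have wlog_n : ln n%:R `^ c < wmin (w n) by near: n.
  have wmin0 : 0 < wmin (w n) := le_lt_trans (powR_ge0 _ _) wlog_n.
  have dl01 : 0 <= dl n <= 1 / 2.
    rewrite !mulr_ge0 ?powR_ge0 //=; last lra.
    by near: n.
  have hK : wmax (w n) <= K * wmin (w n) by near: n.
  have hB : forall i : 'I_n, v n i 0 <= B / n%:R by near: n.
  apply: le_trans (pagerank_err_tail (w n) (w_pos n) wmin0 (w_CL n) alpha K B kap _ _
    halpha n0 (v_prob n n0) hK hB KBkap dl01).
  rewrite lerD2l lerN2 -mulrA ler_pM2l // powR_inv1 ?ler0n //.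
  have nR : 0 < n%:R :> R by rewrite ltr0n.
  rewrite -ler_pdivlMl // -expr2 exprVn -[n%:R in X in _ <= X]lnK ?posrE //.
  rewrite -expRM_natl -expRN ler_expR lerN2.
  have dl2 : dl n ^+ 2 = 16 * kap ^+ 2 * (ln n%:R / ln n%:R `^ c).
    rewrite /dl !exprMn -(powR_mulrn 2 (powR_ge0 _ (- s))) -powRrM.
    have -> : - s * 2 = 1 - c by rewrite /s; field.
    by rewrite powRB ?(gt_eqF L0) ?implybT // powRr1 ?(ltW L0) //; ring.
  have Lc0 : 0 < ln n%:R `^ c by rewrite powR_gt0.
  have -> : dl n ^+ 2 * (wmin (w n) / kap) / 8 =
     2 * ln n%:R * (kap * (wmin (w n) / ln n%:R `^ c)).
    by rewrite dl2; field; rewrite !gt_eqF //; lra.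
  rewrite ler_peMr ?mulr_ge0 ?(ltW L0) // mulr_ege1 //.
  by rewrite ler_pdivlMr // mul1r ltW.
move=> [N _ hN]; exists N, 1, 4; split=> // n Nn.
by apply: hN => /=; exact: ltnW.
Unshelve. all: by end_near.
Qed.
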